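(* Let $p_0,p_1$ be probability distributions on $\mathbb{R}^d$ and let $(p_t)_{t\in[0,1]}$ be a probability path with endpoints $p_0$ and $p_1$. Assume there exists a ground truth velocity field $u:[0,1]\times\mathbb{R}^d\to\mathbb{R}^d$ that generates $(p_t)_{t\in[0,1]}$ and satisfies the continuity equation $\partial_t p_t(x)=-\nabla\cdot(u(t,x)p_t(x))$, and assume that $u$ is bounded. Let $v_\theta:[0,1]\times\mathbb{R}^d\to\mathbb{R}^d$ be bounded and twice continuously differentiable with bounded first and second derivatives, and put $$f_\theta(t,x)=x+(1-t)\,v_\theta(t,x).$$ Then, as $\Delta t\to0^+$, $$E\big\| f_\theta(t,x_{t}) - f_{\theta}(t+\Delta t,x_{t+\Delta t})\big\|_2^2 = (\Delta t)^2\, E\big\|v_\theta(t,x_t)-u(t,x_t)-(1-t)\big(\partial_t v_\theta + u \cdot \nabla_x v_\theta\big)(t,x_t)\big\|_2^2 + o((\Delta t)^2),$$ where on both sides the expectation is over $t$ uniformly distributed on $[0,1-\Delta t]$ and, independently of $t$, over the random trajectory $(x_s)_{s\in[0,1]}$ generated by $u$.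
   Context: ''$u$ generates $(p_t)$'' means: the trajectory $(x_s)_{s\in[0,1]}$ has random initial point $x_0\sim p_0$, solves the ODE $\frac{d x_s}{ds}=u(s,x_s)$, i.e. $x_t-x_s=\int_s^t u(r,x_r)\,dr$ for $0\le s\le t\le 1$, and satisfies $x_s\sim p_s$ for every $s\in[0,1]$. The points $x_t$ and $x_{t+\Delta t}$ lie on the same trajectory. Notation: $u\cdot\nabla_x v_\theta$ is the directional derivative of $v_\theta$ in the space variable along $u$, i.e. $(u\cdot\nabla_x v_\theta)(t,x)=\big(D_xv_\theta(t,x)\big)u(t,x)$ with $D_x v_\theta$ the Jacobian matrix in $x$. The parameter $\theta$ is fixed (the same $\theta$ appears in both terms on the left; no exponential moving average is used). *)

(* Defs.v *)
From HB Require Import structures.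
From mathcomp Require Import all_boot all_order all_algebra.
From mathcomp Require Import all_classical all_reals all_analysis.
Set Implicit Arguments.
Unset Strict Implicit.
Unset Printing Implicit Defensive.
Import Order.TTheory GRing.Theory Num.Theory.
Import numFieldNormedType.Exports.
Local Open Scope classical_set_scope.
Local Open Scope ring_scope.

(* MathComp-Analysis puts no sigma-algebra on row vectors: this is R^d with its
   Borel sets. *)
Definition borelV (R : realType) (d : nat) :=
  g_sigma_algebraType (@open 'rV[R]_d).

(* The norm of the library on 'rV[R]_d is the sup norm; this is the squared
   Euclidean norm. *)
Definition sqnorm2 (R : realType) (d : nat) (x : 'rV[R]_d) : R :=
  \sum_(i < d) x 0 i ^+ 2.

Section Slab.
Context (R : realType) (d : nat).

(* Functions on [0,1] x R^d are represented by total functions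
   R -> 'rV[R]_d -> W, whose values outside the slab play no role. *)
Definition slab : set (R * 'rV[R]_d) := [set` `[0, 1]] `*` setT.

Context (W : normedModType R).
Implicit Type f : R -> 'rV[R]_d -> W.

(* Increments that leave [0,1] are excluded, so that the time derivative is
   one-sided at t = 0 and t = 1. *)
Definition time_incr (t : R) : set_system R :=
  within [set h | t + h \in `[0, 1]] 0^'.

Definition time_quot f (t : R) (x : 'rV[R]_d) (h : R) : W :=
  h^-1 *: (f (t + h) x - f t x).

(* None stands for the time variable, Some i for the i-th space variable. *)
Definition pderiv (a : option 'I_d) f : R -> 'rV[R]_d -> W :=
  match a with
  | None => fun t x => lim (time_quot f t x @ time_incr t)
  | Some i => fun t x => 'D_(delta_mx 0 i) (f t) x
  end.

(* f is of class C^k on the closed slab [0,1] x R^d. *)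
Fixpoint Ck_slab (k : nat) f : Prop :=
  {within slab, continuous (fun z => f z.1 z.2)} /\
  match k with
  | 0 => True
  | k'.+1 =>
      (forall t x, t \in `[0, 1] ->
         cvg (time_quot f t x @ time_incr t) /\ differentiable (f t) x) /\
      (forall a, Ck_slab k' (pderiv a f))
  end.

Definition bounded_slab f : Prop :=
  exists M : R, forall t x, t \in `[0, 1] -> `|f t x| <= M.

End Slab.

Section FlowMatching.
Context (R : realType) (d : nat).
Implicit Types (u v : R -> 'rV[R]_d -> 'rV[R]_d).
Implicit Type p : R -> probability (borelV R d) R.

Definition measurable_field u : Prop :=
  measurable_fun ([set` `[0, 1]] `*` setT : set (R * borelV R d))
    (fun z => u z.1 z.2 : borelV R d).

(* The vector-valued integral equation is stated coordinate by coordinate. *)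
Definition solves_ode u (x : R -> 'rV[R]_d) : Prop :=
  forall i : 'I_d,
    lebesgue_measure.-integrable `[0, 1] (fun r => (u r (x r) 0 i)%:E) /\
    (forall s t : R, 0 <= s -> s <= t -> t <= 1 ->
       x t 0 i - x s 0 i = \int[lebesgue_measure]_(r in `[s, t]) u r (x r) 0 i).

Record generates (dO : measure_display) (Omega : measurableType dO)
    (P : probability Omega R) (X : R -> Omega -> 'rV[R]_d) u p : Prop := {
  gen_measurable : forall s, s \in `[0, 1] ->
    measurable_fun [set: Omega] (X s : Omega -> borelV R d);
  gen_ode : forall w : Omega, solves_ode u (fun s => X s w);
  gen_law : forall s, s \in `[0, 1] ->
    forall B : set (borelV R d), measurable B -> P (X s @^-1` B) = p s B
}.

(* phi belongs to C_c^infty(]0,1[ x R^d). *)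
Definition test_function (phi : R -> 'rV[R]_d -> R^o) : Prop :=
  (forall k, Ck_slab k phi) /\
  exists K : set (R * 'rV[R]_d),
    [/\ compact K, K `<=` [set` `]0, 1[] `*` setT
      & forall t x, ~ K (t, x) -> phi t x = 0].

(* d_t p_t = - div (u p_t) in the sense of distributions on ]0,1[ x R^d; the
   p_t are arbitrary probability measures and need not have densities. *)
Definition continuity_equation u p : Prop :=
  forall phi : R -> 'rV[R]_d -> R^o, test_function phi ->
    (\int[lebesgue_measure]_(t in `[0%R, 1%R]) \int[p t]_x
       (pderiv None phi t x
        + \sum_(i < d) u t x 0 i * pderiv (Some i) phi t x)%:E = 0)%E.

Definition flow_end v (t : R) (x : 'rV[R]_d) : 'rV[R]_d :=
  x + (1 - t) *: v t x.

(* d_t v + u . grad_x v; the Jacobian of the library acts on row vectors from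
   the right. *)
Definition total_deriv u v (t : R) (x : 'rV[R]_d) : 'rV[R]_d :=
  pderiv None v t x + u t x *m 'J (v t) x.

End FlowMatching.

(* Main.v *)
(* Along a trajectory the curve s |-> f(s, x_s) is Lipschitz, uniformly in the
   trajectory, and by Lebesgue differentiation it has derivative
   u - v + (1 - s) (d_t v + u . grad v) at almost every s.  Hence the squared
   difference quotient of step D is bounded and converges, for each trajectory
   and almost every time, to the squared norm on the right-hand side.  Dominated
   convergence, first in time and then over the trajectories, makes the rescaled
   error o(1). *)

Require Import Defs.
From HB Require Import structures.
From mathcomp Require Import all_boot all_order all_algebra.
From mathcomp Require Import all_classical all_reals all_analysis.
From mathcomp Require Import measurable_realfun ring lra.
Import Order.TTheory GRing.Theory Num.Theory.
Import numFieldNormedType.Exports.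
Local Open Scope classical_set_scope.
Local Open Scope ring_scope.

(** * Integrals and joint measurability *)

(** Two obstacles shape the proof. The law of the time variable changes with [D], whereas dominated
    convergence wants one fixed measure; so the uniform law is traded for Lebesgue measure at the
    cost of a factor [(1 - D)^-1], at most 2 for small [D], and the moving interval [[0, 1 - D]] is
    put into the integrand as a restriction. Second, measurability in time and sample point jointly
    is not part of the data: it is recovered from the continuity of the trajectories for the terms
    in [v], and by composition with the trajectory for the terms in [u], which need not be
    continuous. *)

Section IntegralFullSet.
Import HBNNSimple.

(* No measurability of f: the trajectories are unconstrained outside [0,1], so
   the integrands of the theorem may fail to be measurable off the slab. *)
Lemma integral_full_set d (T : measurableType d) (R : realType)
    (mu : {measure set T -> \bar R}) (N : set T) (f : T -> \bar R) :
  measurable N -> mu N = 0%E -> (forall x, (0 <= f x)%E) ->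
  (\int[mu]_x f x = \int[mu]_(x in ~` N) f x)%E.
Proof.
move=> mN N0 f0; have mNC := measurableC mN.
rewrite [RHS]integral_mkcond !ge0_integralTE//; last first.
  by move=> x; rewrite patchE; case: ifP.
apply/eqP; rewrite eq_le; apply/andP; split.
- apply: ereal_sup_le => _ /= [h hf <-]; exists (proj_nnsfun h mNC).
    move=> x; rewrite -mrestrict !patchE; case: ifP => // _; exact: hf.
  rewrite -mrestrict -integral_nnsfun// -integralT_nnsfun -setTD.
  apply/esym/ge0_negligible_integral => //.
  + by apply/measurable_EFinP; exact: measurable_funPT.
  + by move=> x _; rewrite lee_fin.
- apply: ereal_sup_le => _ /= [h hf <-]; exists h => // x.
  by apply: (le_trans (hf x)); rewrite patchE; case: ifP.
Qed.

End IntegralFullSet.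

(** Joint measurability of a function measurable in the sample point and continuous in time.
    Phrasing it with open preimages lets it serve both real integrands and the vector-valued
    trajectory itself. *)
Lemma caratheodory_preimage_open (R : realType) dO (Omega : measurableType dO)
    (W : pseudoMetricType R) (F : R -> Omega -> W) :
  (forall s, s \in `[0, 1] -> forall U, open U -> measurable (F s @^-1` U)) ->
  (forall w, {within `[0, 1], continuous (F^~ w)}) ->
  forall U, open U -> measurable
    ((`[0, 1]%classic `*` setT) `&` (fun z => F z.1 z.2) @^-1` U :
      set (measurableTypeR R * Omega)).
Proof.
move=> mF cF U oU.
(* F is the pointwise limit of the functions F (s n t) w, which are piecewise
   constant in t; the closed sets V k, increasing to U, make membership of the limit in
   U equivalent to some V k eventually containing the sequence. *)
pose s (n : nat) (t : R) := (Num.truncn (t * n.+1%:R))%:R / n.+1%:R : R.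
pose V (k : nat) := ~` \bigcup_(y in ~` U) (ball y k.+1%:R^-1)°.
have oV k : open (~` V k).
  by rewrite /V setCK; apply: bigcup_open => y _; exact: open_interior.
have sP n t : t \in `[0, 1] -> s n t \in `[0, 1] /\ `|t - s n t| <= n.+1%:R^-1.
  rewrite !in_itv/= => /andP[t0 t1].
  have n0 : 0 < n.+1%:R :> R by [].
  have /andP[a b] := truncn_itv (mulr_ge0 t0 (ltW n0)).
  rewrite /s; split; first (apply/andP; split).
  - by rewrite divr_ge0.
  - rewrite ler_pdivrMr// mul1r; apply: (le_trans a).
    by rewrite ler_piMl// ltW.
  - rewrite ger0_norm ?subr_ge0 ?ler_pdivrMr//.
    by rewrite lerBlDl -[X in _ + X]mul1r -mulrDl ler_pdivlMr// natr1 ltW.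
have cvgs t w : t \in `[0, 1] -> F (s n t) w @[n --> \oo] --> F t w.
  move=> t01.
  have st : s n t @[n --> \oo] --> t.
    apply/cvgrPdist_le => e e0; near=> n.
    apply: (le_trans (sP n t t01).2); apply: ltW; near: n.
    exact: (near_infty_natSinv_lt (PosNum e0)).
  have /subspace_continuousP/(_ _ t01) := cF w.
  apply: cvg_comp => A /= At.
  have : \forall n \near \oo, s n t \in `[0, 1] -> A (s n t) := st _ At.
  apply: filterS => n h.
  by apply: h; have [] := sP n t t01.
have -> : (`[0, 1]%classic `*` setT) `&` (fun z => F z.1 z.2) @^-1` U =
    \bigcup_k \bigcup_N \bigcap_(n in [set n | (N <= n)%N])
      ((`[0, 1]%classic `*` setT) `&` (fun z => F (s n z.1) z.2) @^-1` V k)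
    :> set (measurableTypeR R * Omega).
  apply/seteqP; split => [[t w] [[/= t01 _] UF]|[t w] [k _] [N _] FV].
  - have /nbhs_ballP[e e0 eU] := open_nbhs_nbhs (conj oU UF).
    (* Half of [e]: the distance to the limit and the radius of a removed ball each cost
       [k.+1%:R^-1]. *)
    have [k _ /(_ k (leqnn k)) ke] :=
      near_infty_natSinv_lt (PosNum (divr_gt0 e0 (ltr0Sn R 1))).
    have e2 : 0 < k.+1%:R^-1 :> R by rewrite invr_gt0.
    have [N _ FN] := cvg_ball (cvgs t w t01) e2.
    exists k => //; exists N => // n /= Nn.
    split => //= -[y Uy /interior_subset ky].
    apply: Uy; apply: eU => /=.
    have := ball_triangle (FN n Nn) (ball_sym ky).
    apply: le_ball; rewrite [e]splitr; apply: ltW; exact: ltrD.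
  - have t01 : t \in `[0, 1] by have [[]] := FV N (leqnn N).
    split => //=; apply: contrapT => nU.
    have k0 : 0 < k.+1%:R^-1 :> R by rewrite invr_gt0.
    (* A limit outside [U] would be the centre of a ball removed from [V k], and the sequence
       eventually enters that ball. *)
    have [M _ FM] := (cvgs t w t01) _
      (nbhs_interior (nbhsx_ballx (F t w) _ k0)).
    have [_ /=] := FV (maxn N M) (leq_maxl _ _).
    apply; exists (F t w) => //; apply: FM; exact: leq_maxr.
apply: bigcupT_measurable => k; apply: bigcupT_measurable => N.
apply: bigcap_measurable => [|n _]; first by exists N => /=.
(* [s n] is constant on each cell, so the set is a countable union of rectangles. *)
pose I (j : nat) : set R := `[0, 1] `&` `[j%:R / n.+1%:R, j.+1%:R / n.+1%:R[.
have -> : (`[0, 1]%classic `*` setT) `&` (fun z => F (s n z.1) z.2) @^-1` V k =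
    \bigcup_j (I j `*` (F (j%:R / n.+1%:R) @^-1` V k))
    :> set (measurableTypeR R * Omega).
  have n0 : 0 < n.+1%:R :> R by [].
  apply/seteqP; split => [[t w] /= [[t01 _] Vt]|[t w] [j _] [/= [t01 tj] Vt]].
  - exists (Num.truncn (t * n.+1%:R)) => //; split => //; split => //=.
    move: t01; rewrite !in_itv/= => /andP[t0 t1].
    by rewrite ler_pdivrMr// ltr_pdivlMr// truncn_itv// mulr_ge0// ltW.
  - split => //=; suff -> : s n t = j%:R / n.+1%:R by [].
    rewrite /s (@truncn_def _ _ j)//.
    by move: tj => /=; rewrite in_itv/= ler_pdivrMr// ltr_pdivlMr.
apply: bigcupT_measurable => j.
(* The case [j = n.+1] is kept because its cell contains the time 1. For larger [j] the cell is
   empty, and [F] is sampled at a time where no measurability is assumed. *)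
have [jn|nj] := leqP j n.+1.
- apply: measurableX; first exact: measurableI.
  rewrite -[V k]setCK preimage_setC; apply: measurableC.
  apply: (mF _ _ _ (oV k)).
  by rewrite in_itv/= divr_ge0//= ler_pdivrMr// mul1r ler_nat.
- rewrite (_ : I j = set0) ?set0X//; apply/seteqP; split => // t [] /=.
  rewrite !in_itv/= => /andP[_ t1] /andP[jt _].
  have : j%:R / n.+1%:R <= 1 :> R by exact: le_trans jt t1.
  by rewrite ler_pdivrMr// mul1r ler_nat leqNgt nj.
Unshelve. all: by end_near. Qed.

Lemma integral_slab_le (R : realType) dO (Omega : measurableType dO)
    (K : measurableTypeR R * Omega -> R) (C : R) (w : Omega) :
  measurable_fun setT K -> (forall z, 0 <= K z <= C * \1_(`[0, 1]) z.1) ->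
  (\int[lebesgue_measure]_t (K (t, w))%:E <= (`|C|)%:E)%E.
Proof.
move=> mK K0C; pose mu := @lebesgue_measure R.
have -> : (`|C|)%:E = (\int[mu]_(t in `[0%R, 1%R]) (`|C|)%:E)%E.
  by rewrite integral_cst//= lebesgue_measure_itv/= lte01 oppr0 adde0 mule1.
rewrite [leRHS]integral_mkcond; apply: ge0_le_integral => //.
- by move=> t _; rewrite lee_fin; case/andP: (K0C (t, w)).
- by apply/measurable_EFinP; exact: (measurable_fun_pair1 w mK).
- by apply: (measurable_restrictT _ _).1.
- move=> t _; rewrite patchE; have /andP[_] := K0C (t, w); rewrite /= indicE.
  case: ifPn => _; rewrite ?mulr1 ?mulr0 lee_fin //.
  by move=> /le_trans; apply; exact: ler_norm.
Qed.

(* Dominated convergence is applied to the iterated integral, so that the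
   exceptional set only needs to have null time sections; nothing is known about
   its measurability in the product. *)
Lemma cvg0_integral_slab (R : realType) dO (Omega : measurableType dO)
    (P : probability Omega R) (K : nat -> measurableTypeR R * Omega -> R)
    (C : R) :
  (forall n, measurable_fun setT (K n)) ->
  (forall n z, 0 <= K n z <= C * \1_(`[0, 1]) z.1) ->
  (forall w, {ae (@lebesgue_measure R),
    forall t, K n (t, w) @[n --> \oo] --> 0}) ->
  (\int[P]_w \int[lebesgue_measure]_t (K n (t, w))%:E)%E @[n --> \oo] --> 0%E.
Proof.
move=> mK K0C Kcvg; pose mu := @lebesgue_measure R.
have mEK n : measurable_fun setT (EFin \o K n) by exact/measurable_EFinP.
have K0 n z : (0 <= (EFin \o K n) z)%E by rewrite lee_fin; case/andP: (K0C n z).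
pose G n := fubini_G mu (EFin \o K n).
have ig : mu.-integrable setT (fun t => (C * \1_(`[0, 1]) t)%:E).
  under [X in _.-integrable _ X]eq_fun do rewrite EFinM.
  apply: integrableZl => //; exact: integrable_indic_itv.
have G0 n w : (0 <= G n w)%E by apply: integral_ge0 => t _; exact: K0.
have mt n w : measurable_fun setT (fun t => (K n (t, w))%:E).
  exact: (measurable_fun_pair1 w (mEK n)).
have GC n w : (G n w <= (`|C|)%:E)%E. exact: integral_slab_le.
have cG w : G n w @[n --> \oo] --> 0%E.
  have := @dominated_convergence _ _ R mu setT measurableT
    (fun n t => (K n (t, w))%:E) (cst 0%E) (fun t => (C * \1_(`[0, 1]) t)%:E).
  case=> //.
  - apply: filterS (Kcvg w) => t Kt _.
    by apply: cvg_EFin => //; exact: nearW.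
  - apply: aeW => t n _; have /andP[k0 k1] := K0C n (t, w).
    by rewrite gee0_abs ?lee_fin.
  - by move=> _ _; rewrite integral0; apply.
have := @dominated_convergence _ _ R P setT measurableT
    G (cst 0%E) (cst (`|C|)%:E).
case=> //.
- move=> n; apply: (@measurable_fun_fubini_tonelli_G _ _ _ _ _ mu _ (mEK n)).
  exact: K0.
- by apply: aeW => w _; exact: cG.
- exact: finite_measure_integrable_cst.
- by apply: aeW => w n _; rewrite gee0_abs.
- by move=> _ _; rewrite integral0; apply.
Qed.

(** * The remainder *)

Section UniformTime.
Context (R : realType) (dO : measure_display) (Omega : measurableType dO).
Context (P : probability Omega R) (D : R) (hD : 0 < 1 - D).
Implicit Types f A B : measurableTypeR R * Omega -> R.

Local Notation Q := (uniform_prob hD \x P)%E.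
Local Notation S :=
  ((`[0, 1 - D]%classic `*` setT) : set (measurableTypeR R * Omega)).

Let mS : measurable S. Proof. exact: measurableX. Qed.

(** The uniform law charges only [[0, 1 - D]], so the complement of [S] is null. This confines the
    expectation to the region where measurability can be proved. *)
Lemma expectation_uniform_slab f : (forall z, 0 <= f z) ->
  ('E_Q[f] = \int[Q]_(z in S) (f z)%:E)%E.
Proof.
move=> f0; rewrite expectation.unlock.
rewrite (@integral_full_set _ _ _ Q (~` S)) ?setCK//; last 2 first.
- exact: measurableC.
- have -> : ~` S = (~` `[0, 1 - D]%classic) `*` setT.
    by apply/seteqP; split => -[t w] /=; tauto.
  have mI : measurable (~` `[0, 1 - D]%classic : set R) by exact: measurableC.
  apply: (etrans (product_measure1E (uniform_prob hD) P mI measurableT)).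
  by rewrite /= /uniform_prob integral_uniform_pdf setICl integral_set0 mul0e.
Qed.

(** Tonelli puts time in the inner integral, where the uniform density is [(1 - D)^-1]. The measures
    on the right no longer depend on [D]. *)
Lemma uniform_slab_le f : (forall z, 0 <= f z) -> measurable_fun S f ->
  (\int[Q]_(z in S) (f z)%:E <= ((1 - D)^-1)%:E *
    \int[P]_w \int[lebesgue_measure]_t ((f \_ S) (t, w))%:E)%E.
Proof.
move=> f0 mf.
have g0 z : 0 <= (f \_ S) z by rewrite patchE; case: ifP.
have mg : measurable_fun setT (EFin \o (f \_ S)).
  by apply/measurable_EFinP; apply: (measurable_restrictT _ _).1.
have mgt w : measurable_fun setT (fun t => ((f \_ S) (t, w))%:E).
  exact: (measurable_fun_pair1 w mg).
have gE0 z : (0 <= (EFin \o (f \_ S)) z)%E by rewrite lee_fin.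
have -> : (\int[Q]_(z in S) (f z)%:E =
    \int[P]_w fubini_G (uniform_prob hD) (EFin \o (f \_ S)) w)%E.
  have FT := @fubini_tonelli2 _ _ _ _ _ (uniform_prob hD) P _ mg gE0.
  apply: (etrans _ FT).
  rewrite integral_mkcond; apply: eq_integral => z _.
  by rewrite /= !patchE; case: ifP.
rewrite -ge0_integralZl//; last 3 first.
- apply: (@measurable_fun_fubini_tonelli_G _ _ _ _ _ lebesgue_measure _ mg).
  by move=> z; rewrite lee_fin.
- by move=> w _; apply: integral_ge0 => t _; rewrite lee_fin.
- by rewrite lee_fin invr_ge0 ltW.
apply: ge0_le_integral => //.
- by move=> w _; apply: integral_ge0 => t _; rewrite lee_fin.
- exact: (@measurable_fun_fubini_tonelli_G _ _ _ _ _
    (uniform_prob hD) _ mg gE0).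
- apply: measurable_funeM.
  exact: (@measurable_fun_fubini_tonelli_G _ _ _ _ _ lebesgue_measure _ mg gE0).
move=> w _; rewrite /fubini_G integral_uniform/=; last 2 first.
- exact: mgt.
- by move=> t; rewrite lee_fin.
rewrite subr0 lee_pmul2l ?lte_fin ?invr_gt0// ?fin_numE//.
by apply: ge0_subset_integral => // t _; rewrite lee_fin.
Qed.

(** The remainder is the integral of [A - D ^+ 2 * B]; factoring out [D ^+ 2] leaves the L1 distance
    between the rescaled error and its limit. The bounds [CA] and [CB] make both expectations
    finite, so that they can be subtracted. *)
Lemma expectation_remainder A B (CA CB : R) : 0 < D ->
  (forall z, 0 <= A z) -> (forall z, 0 <= B z) ->
  measurable_fun S A -> measurable_fun S B ->
  (forall z, S z -> A z <= CA) -> (forall z, S z -> B z <= CB) ->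
  exists r : R, ('E_Q[A] = (D ^+ 2)%:E * 'E_Q[B] + r%:E)%E /\
   (`|r|%:E <= (D ^+ 2)%:E * (((1 - D)^-1)%:E *
    \int[P]_w \int[lebesgue_measure]_t
      (((fun z => `|A z / D ^+ 2 - B z|) \_ S) (t, w))%:E))%E.
Proof.
move=> D0 A0 B0 mA mB AC BC; rewrite !expectation_uniform_slab//.
have D20 : 0 < D ^+ 2 by rewrite exprn_gt0.
have QS : (Q S < +oo)%E.
  by have := @probability_le1 _ _ _ Q S mS; move=> /le_lt_trans; apply; rewrite ltry.
have bnd f C : (forall z, 0 <= f z) -> (forall z, S z -> f z <= C) ->
    [bounded f z | z in S].
  move=> f0 fC; exists C; split; first exact: num_real.
  by move=> M CM z Sz /=; rewrite ger0_norm// (le_trans (fC _ Sz))// ltW.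
have iA := measurable_bounded_integrable mS QS mA (bnd _ _ A0 AC).
have iB := measurable_bounded_integrable mS QS mB (bnd _ _ B0 BC).
have iDB : Q.-integrable S (EFin \o (fun z => D ^+ 2 * B z)).
  by have := integrableZl mS (D ^+ 2) iB; apply: eq_integrable.
exists (\int[Q]_(z in S) A z - D ^+ 2 * \int[Q]_(z in S) B z); split.
  have EA := fineK (integrable_fin_num mS iA).
  have EB := fineK (integrable_fin_num mS iB).
  by rewrite /Rintegral -EA -EB/= -EFinM -EFinD; congr EFin; ring.
rewrite -RintegralZl// -RintegralB//.
have iAB : Q.-integrable S (EFin \o (fun z => A z - D ^+ 2 * B z)).
  by have := integrableB mS iA iDB; apply: eq_integrable.
rewrite (EFin_normr_Rintegral mS iAB).
apply: le_trans; first by apply: le_abse_integral => //; case/integrableP : iAB.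
have mAB : measurable_fun S (fun z => `|A z / D ^+ 2 - B z|).
  apply: measurableT_comp => //; apply: measurable_funB => //.
  exact: measurable_funM.
have -> : (\int[Q]_(z in S) `|(EFin \o (fun z => (A z - D ^+ 2 * B z)%R)) z| =
    (D ^+ 2)%:E * \int[Q]_(z in S) (`|(A z / D ^+ 2 - B z)%R|)%:E)%E.
  rewrite -ge0_integralZl//; last first.
  - exact: ltW.
  - exact/measurable_EFinP.
  apply: eq_integral => z _ /=; rewrite -EFinM; congr EFin.
  have -> : A z - D ^+ 2 * B z = D ^+ 2 * (A z / D ^+ 2 - B z).
    by field; rewrite gt_eqF.
  by rewrite normrM (gtr0_norm D20).
by rewrite lee_pmul2l// ?lte_fin//; apply: uniform_slab_le.
Qed.

End UniformTime.

(** The passage to the limit, detached from the flow: [A D] stands for the squared increment of step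
    [D], [B] for the limit of its rescaling, and [C] yields the dominating function. *)
Lemma expectation_littleo (R : realType) dO (Omega : measurableType dO)
    (P : probability Omega R) (A : R -> measurableTypeR R * Omega -> R)
    (B : measurableTypeR R * Omega -> R) (C : R) :
  (forall D z, 0 <= A D z) -> (forall z, 0 <= B z) ->
  (forall D, 0 < D ->
    measurable_fun
      ((`[0, 1 - D]%classic `*` setT) : set (measurableTypeR R * Omega))
      (A D)) ->
  measurable_fun
    ((`[0, 1]%classic `*` setT) : set (measurableTypeR R * Omega)) B ->
  (forall D t w, 0 < D -> t \in `[0, 1 - D] -> A D (t, w) <= C * D ^+ 2) ->
  (forall t w, t \in `[0, 1] -> B (t, w) <= C) ->
  (forall w, {ae (@lebesgue_measure R), forall t, t \in `]0, 1[ ->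
    A D (t, w) / D ^+ 2 @[D --> 0^'+] --> B (t, w)}) ->
  exists rem : R -> R,
    (rem : R^o -> R^o) =o_ (0^'+) (fun D : R^o => D ^+ 2 : R^o) /\
    forall (D : R) (hD : 0 < 1 - D), 0 < D ->
      ('E_(uniform_prob hD \x P)[A D]
       = (D ^+ 2)%:E * 'E_(uniform_prob hD \x P)[B] + (rem D)%:E)%E.
Proof.
move=> A0 B0 mA mB AC BC AB.
pose S D := (`[0, 1 - D]%classic `*` setT) : set (measurableTypeR R * Omega).
pose K D := (fun z => `|A D z / D ^+ 2 - B z|) \_ (S D).
pose Phi D := (\int[P]_w \int[lebesgue_measure]_t (K D (t, w))%:E)%E.
have mS D : measurable (S D) by exact: measurableX.
have SS D : 0 < D -> S D `<=` (`[0, 1]%classic `*` setT).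
  move=> D0 [t w] [/= + _]; rewrite !in_itv/= => /andP[t0 t1]; split => //=.
  by rewrite t0 (le_trans t1)// gerBl ltW.
have mBS D : 0 < D -> measurable_fun (S D) B.
  by move=> D0; apply: (measurable_funS _ (SS _ D0) mB); exact: measurableX.
have mK D : 0 < D -> measurable_fun setT (K D).
  move=> D0; apply: (measurable_restrictT _ (mS D)).1.
  apply: measurableT_comp => //; apply: measurable_funB; last exact: mBS.
  by apply: measurable_funM => //; exact: mA.
have K0 D z : 0 <= K D z by rewrite /K patchE; case: ifP.
have KC D z : 0 < D -> K D z <= (C + C) * \1_(`[0, 1]) z.1.
  move=> D0; rewrite /K patchE; case: z => t w /=.
  have [/set_mem/= Sz|_] := boolP ((t, w) \in S D).
    have [/= t01 _] := SS _ D0 _ Sz; have [/= tD _] := Sz.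
    rewrite indicE mem_set// mulr1.
    apply: (le_trans (ler_normB _ _)); rewrite !ger0_norm ?divr_ge0 ?sqr_ge0//.
    by apply: lerD; [rewrite ler_pdivrMr ?exprn_gt0// AC|exact: BC].
  have [t01|] := pselect (`[0, 1]%classic t); last first.
    by move=> nt; rewrite indicE memNset// mulr0.
  rewrite indicE mem_set// mulr1.
  by have C0 := le_trans (B0 (t, w)) (BC t w t01); rewrite addr_ge0.
(* Dominated convergence concerns sequences, so the limit at [0^'+] is tested along sequences of
   positive steps. *)
have KPhi (a : R^nat) : (forall n, 0 < a n) /\ a @ \oo --> 0 ->
    Phi (a n) @[n --> \oo] --> 0%E.
  move=> [a0 acvg].
  apply: (@cvg0_integral_slab _ _ _ P (fun n => K (a n)) (C + C)).
  - by move=> n; exact: mK.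
  - by move=> n z; rewrite K0 KC.
  move=> w; have ae0 : {ae (@lebesgue_measure R), forall t, t != 0}.
    exists [set 0]; split => //; first exact: lebesgue_measure_set1.
    by move=> t /= /negP; rewrite negbK => /eqP.
  move: (AB w) ae0; apply: filterS2.
    exact: (ae_filter_ringOfSetsType (@lebesgue_measure R)).
  move=> t ABt t0.
  (* Outside []0, 1[] no limit of the quotient is known, but [K] vanishes there: membership in
     [S (a n)] forces [0 <= t < 1], and [t = 0] has been discarded as a null set. *)
  have [t01|nt] := boolP (t \in `]0, 1[); last first.
    apply: cvg_near_cst; apply: nearW => n; rewrite /K patchE memNset//=.
    move=> [/= + _]; apply/negP; apply: contra nt; rewrite !in_itv/=.
    move=> /andP[t0' t1]; rewrite lt_neqAle eq_sym t0 t0'/=.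
    by rewrite (le_lt_trans t1)// gtrBl.
  have cA : A (a n) (t, w) / a n ^+ 2 @[n --> \oo] --> B (t, w).
    exact: (cvg_at_rightP _ _ _).1 (ABt t01) a (conj a0 acvg).
  apply: (@squeeze_cvgr _ _ _ _ (cst 0)
    (fun n => `|A (a n) (t, w) / a n ^+ 2 - B (t, w)|)).
  - apply: nearW => n; rewrite /= K0/= /K patchE; case: ifP => _ //.
    exact: normr_ge0.
  - exact: cvg_cst.
  - rewrite -(@normr0 _ R) -[X in `|X|](subrr (B (t, w))).
    by apply: cvg_norm; apply: cvgB => //; exact: cvg_cst.
have Phicvg : fine (Phi D) @[D --> 0^'+] --> 0.
  by apply/cvg_at_rightP => a aP; apply/fine_cvg; exact: KPhi.
(* The remainder must be a function of [D] alone, while the measure mentions the proof [hD]; hence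
   [r] is chosen before [hD], and proof irrelevance identifies the proofs. Where [D] is out of
   range, [r] is 0. *)
have remP D : {r : R | forall hD : 0 < 1 - D, 0 < D ->
    ('E_(uniform_prob hD \x P)[A D] =
      (D ^+ 2)%:E * 'E_(uniform_prob hD \x P)[B] + r%:E)%E /\
    (`|r|%:E <= (D ^+ 2)%:E * (((1 - D)^-1)%:E * Phi D))%E}.
  apply: cid; have [hD|nhD] := pselect (0 < 1 - D); last first.
    by exists 0 => hD; case: nhD.
  have [D0|nD] := pselect (0 < D); last by exists 0 => hD' D0; case: nD.
  have [||r rP] := @expectation_remainder R dO Omega P D hD (A D) B
    (C * D ^+ 2) C D0 (A0 D) B0 (mA D D0) (mBS D D0).
  - by move=> [t w] [/= tD _]; exact: AC.
  - by move=> z /(SS _ D0) [/= t01 _]; case: z t01 => t w; exact: BC.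
  - by exists r => hD' _; rewrite (bool_irrelevance hD' hD).
have PhiC D : 0 < D -> Phi D \is a fin_num.
  move=> D0; have i0 w : (0 <= \int[lebesgue_measure]_t (K D (t, w))%:E)%E.
    by apply: integral_ge0 => t _; rewrite lee_fin.
  apply: integrable_fin_num => //.
  have mG : measurable_fun setT (fubini_G lebesgue_measure (EFin \o K D)).
    apply: (@measurable_fun_fubini_tonelli_G _ _ _ _ _ lebesgue_measure).
      by apply/measurable_EFinP; exact: mK.
    by move=> z; rewrite lee_fin.
  apply: (le_integrable _ mG _
    (finite_measure_integrable_cst P `|C + C| _)) => //.
  move=> w _; rewrite gee0_abs; last exact: i0.
  rewrite gee0_abs//=; apply: integral_slab_le; first exact: mK.
  by move=> z; rewrite K0 KC.
exists (fun D => sval (remP D)); split; last first.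
  by move=> D hD D0; case: (remP D) => r /= /(_ hD D0)[].
apply/eqoP => e e0; near=> D.
have D0 : 0 < D by near: D; exact: nbhs_right_gt.
(* This keeps [(1 - D)^-1] below 2, so that [Phi D <= e / 2] suffices. *)
have D2 : D < 2^-1 by near: D; apply: nbhs_right_lt; rewrite invr_gt0.
have hD : 0 < 1 - D by lra.
case: (remP D) => r /= /(_ hD D0)[_].
rewrite -(fineK (PhiC D D0)) -!EFinM lee_fin => /le_trans; apply.
rewrite [X in _ <= e * X]ger0_norm ?sqr_ge0// mulrC ler_wpM2r ?sqr_ge0//.
have PhiD : fine (Phi D) <= e / 2.
  apply: (le_trans (ler_norm _)); rewrite -normrN -[X in `|X|]add0r; near: D.
  by move/cvgrPdist_le : Phicvg; apply; rewrite divr_gt0.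
rewrite ler_pdivrMl//; apply: (le_trans PhiD); rewrite mulrC ler_pM2r//; lra.
Unshelve. all: by end_near. Qed.

(** * Trajectories *)

Lemma rV_coord_le (R : realType) d (x : 'rV[R]_d) i : `|x 0 i| <= `|x|.
Proof.
rewrite [leRHS]mx_normrE.
exact: (le_bigmax _ (fun ij : 'I_1 * 'I_d => `|x ij.1 ij.2|) (0, i)).
Qed.

Lemma rV_norm_le (R : realType) d (x : 'rV[R]_d) M :
  0 <= M -> (forall i, `|x 0 i| <= M) -> `|x| <= M.
Proof.
move=> M0 xM; rewrite [leLHS]mx_normrE; apply: bigmax_le => // -[i j] _ /=.
by rewrite (ord1 i).
Qed.

Section Trajectory.
Context (R : realType) (d : nat) (u : R -> 'rV[R]_d -> 'rV[R]_d).
Context (x : R -> 'rV[R]_d) (M : R).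
Hypothesis M0 : 0 <= M.
Hypothesis uM : forall t y, t \in `[0, 1] -> `|u t y| <= M.
Hypothesis xu : solves_ode u x.

(** Each coordinate increment is an integral of a function bounded by [M]; as the norm is the sup
    norm, the constant does not grow with [d]. *)
Lemma ode_lipschitz s t : s \in `[0, 1] -> t \in `[0, 1] ->
  `|x t - x s| <= M * `|t - s|.
Proof.
wlog st : s t / s <= t => [wl s01 t01|].
  have [st|/ltW ts] := leP s t; first exact: wl.
  by rewrite distrC (distrC t); exact: wl.
rewrite !in_itv/= => /andP[s0 s1] /andP[t0 t1].
apply: rV_norm_le => [|i]; first exact: mulr_ge0.
have [ix /(_ s t s0 st t1)] := xu i; rewrite !mxE => ->.
have stS : `[s, t] `<=` (`[0, 1] : set R).
  move=> r /=; rewrite !in_itv/= => /andP[sr rt].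
  by rewrite (le_trans s0)// (le_trans rt).
have ixs : lebesgue_measure.-integrable `[s, t] (fun r => (u r (x r) 0 i)%:E).
  exact: integrableS ix.
apply: (le_trans (le_normr_Rintegral _ ixs)) => //.
have -> : M * `|t - s| = \int[lebesgue_measure]_(r in `[s, t]) M.
  rewrite Rintegral_cst//= lebesgue_measure_itv/= lte_fin.
  have [st'|] := ltP s t; first by rewrite -EFinB/= ger0_norm// subr_ge0.
  by move=> ts; rewrite (@le_anti _ _ s t) ?st// subrr normr0.
apply: le_Rintegral => //.
- exact: (integrable_abse ixs).
- apply: measurable_bounded_integrable => //.
    by rewrite /= lebesgue_measure_itv/=; case: ifP; rewrite -?EFinB ltry.
  by exists M; split => [|N MN r _ /=]; [exact: num_real|rewrite ger0_norm// ltW].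
- move=> r /stS r01; exact: (le_trans (rV_coord_le _ _ _ _) (uM _ _ r01)).
Qed.

(** Each coordinate is the primitive of a merely integrable function, so Lebesgue differentiation
    applies to it; the finitely many coordinates share one null set. *)
Lemma ode_derive : {ae (@lebesgue_measure R), forall t : R, t \in `]0, 1[ ->
  derivable x t 1 /\ 'D_1 x t = u t (x t)}.
Proof.
(* Extension by zero gives a function integrable on the whole line, to which [FTC1] applies with
   base point 0. *)
pose f i := (fun r => u r (x r) 0 i) \_ `[0, 1].
have ifi i : lebesgue_measure.-integrable setT (EFin \o f i).
  have [ix _] := xu i; move: ix; rewrite integrable_mkcond//.
  apply: eq_integrable => // r _; rewrite /= /f !patchE; by case: ifP.
have H i : {ae (@lebesgue_measure R), forall t : R, t \in `]0, 1[ ->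
    is_derive t 1 (fun s => x s 0 i) (u t (x t) 0 i)}.
  have ifiy y : lebesgue_measure.-integrable `[0, y] (EFin \o f i).
    exact: integrableS (ifi i).
  have := @FTC1 R (f i) (BLeft 0) ifiy (open_integrable_locally openT (ifi i)).
  apply: filterS; first exact: (ae_filter_ringOfSetsType lebesgue_measure).
  move=> t /= Ft t01; have := t01; rewrite in_itv/= => /andP[t0 t1].
  have [|dF DF] := Ft; first by rewrite lte_fin.
  have -> : u t (x t) 0 i = f i t.
    by rewrite /f patchE mem_set//= in_itv/= !ltW.
  pose F (y : R) := \int[lebesgue_measure]_(r in `[0, y]) f i r.
  have HF : is_derive t 1 (cst (x 0 0 i) + F) (f i t).
    rewrite -[f i t]add0r -DF; apply: is_deriveD.
    by apply: DeriveDef => //; rewrite derive1E.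
  apply: near_eq_is_derive HF; near=> y.
  have y0 : 0 < y by near: y; exact: lt_nbhsr.
  have y1 : y < 1 by near: y; exact: lt_nbhsl.
  have [_ /(_ 0 y (lexx _) (ltW y0) (ltW y1)) E] := xu i.
  rewrite -[RHS](subrK (x 0 0 i)) E addrC; congr (_ + _).
  apply: eq_Rintegral => r; rewrite inE/= in_itv/= => /andP[r0 ry].
  by rewrite /f patchE mem_set//= in_itv/= r0 (le_trans ry)// ltW.
have : {ae (@lebesgue_measure R), forall (t : R) (i : 'I_d), t \in `]0, 1[ ->
    is_derive t 1 (fun s => x s 0 i) (u t (x t) 0 i)}.
  have F := ae_filter_ringOfSetsType (@lebesgue_measure R).
  exact: filter_forall.
apply: filterS; first exact: (ae_filter_ringOfSetsType lebesgue_measure).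
move=> t Ht t01; have dx : derivable x t 1.
  apply/derivable_mxP => i j; rewrite (ord1 i).
  exact: (@ex_derive _ _ _ _ _ _ _ (Ht j t01)).
split => //; rewrite derive_mx//; apply/rowP => j; rewrite !mxE.
exact: (@derive_val _ _ _ _ _ _ _ (Ht j t01)).
Unshelve. all: by end_near. Qed.

End Trajectory.

(** * The velocity field along a trajectory *)

Lemma within_continuous_coord (R : realType) (T : topologicalType) (S : set T) d
    (f : T -> 'rV[R]_d) j :
  {within S, continuous f} -> {within S, continuous (fun z => f z 0 j)}.
Proof.
move=> cf z; apply: (@continuous_comp (subspace S) _ _ f (fun y => y 0 j)).
  exact: cf.
exact: coord_continuous.
Qed.

Lemma slab_curve_continuous (R : realType) d (W : topologicalType)
    (g : R -> 'rV[R]_d -> W) (y : R -> 'rV[R]_d) :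
  {within @slab R d, continuous (fun z => g z.1 z.2)} ->
  {within `[0, 1], continuous y} ->
  {within `[0, 1], continuous (fun s => g s (y s))}.
Proof.
move=> /subspace_continuousP cg /subspace_continuousP cy.
apply/subspace_continuousP => t /= t01.
have ct : s @[s --> within `[0, 1] (nbhs t)] --> t by exact: cvg_within.
have cp : (s, y s) @[s --> within `[0, 1] (nbhs t)] --> (t, y t).
  exact: (cvg_pair ct (cy t t01)).
have := cg (t, y t) (conj t01 I).
apply: (cvg_comp (fun s => (s, y s)) (fun z => g z.1 z.2)) => A At.
have h1 : \forall s \near within `[0, 1] (nbhs t),
  slab (s, y s) -> A (s, y s) := cp _ At.
have h2 : \forall s \near within `[0, 1] (nbhs t), s \in `[0, 1].
  exact: withinT.
by apply: filterS2 h1 h2 => s As s01; apply: As; split.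
Qed.

Lemma slab_section_continuous (R : realType) d (W : topologicalType)
    (g : R -> 'rV[R]_d -> W) (t : R) :
  {within @slab R d, continuous (fun z => g z.1 z.2)} -> t \in `[0, 1] ->
  continuous (g t).
Proof.
move=> /subspace_continuousP cg t01.
suff H (x : 'rV[R]_d) : g t y @[y --> x] --> g t x by exact: H.
have ct : cst t y @[y --> x] --> t.
  exact: (@cvg_cst R t _ (nbhs x) _).
have cy : y @[y --> x] --> x by move=> A.
have cp : (t, y) @[y --> x] --> (t, x).
  exact: (cvg_pair ct cy).
have := cg (t, x) (conj t01 I).
apply: (cvg_comp (fun y => (t, y)) (fun z => g z.1 z.2)) => A At.
have h1 : \forall y \near x, slab (t, y) -> A (t, y) := cp _ At.
by apply: filterS h1 => y; apply; split.
Qed.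

(** At an interior time every small increment stays in [[0, 1]], so the time derivative is the
    ordinary two-sided one and the mean value theorem is available. *)
Lemma time_incr_interior (R : realType) (t : R) :
  t \in `]0, 1[ -> time_incr t = 0^'.
Proof.
rewrite in_itv/= => /andP[t0 t1].
have D01 : \forall h \near (0 : R)^', t + h \in `[0, 1].
  near=> h; have : `|h| < Num.min t (1 - t).
    by near: h; apply: dnbhs0_lt; rewrite lt_min t0 subr_gt0.
  by rewrite lt_min !ltr_norml in_itv/= => /andP[/andP[? _] /andP[_ ?]]; lra.
apply/seteqP; split => A; rewrite /time_incr /within/= => hA.
  by apply: filterS2 D01 hA => h hD; apply.
by apply: filterS hA => h Ah _.
Unshelve. all: by end_near. Qed.

(** Links the differential, which the chain rule produces, to the partial derivatives, on which the
    continuity and the bounds are given. *)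
Lemma diff_rV (R : realType) d (W : normedModType R) (f : 'rV[R]_d -> W) x h :
  differentiable f x ->
  'd f x h = \sum_i h 0 i *: 'D_(delta_mx 0 i) f x.
Proof.
move=> df; rewrite {1}[h]row_sum_delta linear_sum; apply: eq_bigr => i _.
by rewrite linearZ deriveE.
Qed.

Lemma is_derive_coord (R : realType) d (c : R -> 'rV[R]_d) c' (r : R) j :
  is_derive r 1 c c' -> is_derive r 1 (fun s => c s 0 j) (c' 0 j).
Proof.
move=> [dc <-]; apply: DeriveDef; first by move/derivable_mxP : dc.
by rewrite derive_mx// mxE.
Qed.

Lemma is_derive_curve (R : realType) d (W : normedModType R)
    (f : 'rV[R]_d -> W) (c : R -> 'rV[R]_d) c' (r : R) :
  is_derive r 1 c c' -> differentiable f (c r) ->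
  is_derive r 1 (f \o c) ('d f (c r) c').
Proof.
move=> [/derivable1_diffP dc <-] df.
have dfc : differentiable (f \o c) r by exact: differentiable_comp.
apply: DeriveDef; first exact: diff_derivable.
by rewrite deriveE// diff_comp//= deriveE.
Qed.

Section Velocity.
Context (R : realType) (d : nat) (v : R -> 'rV[R]_d -> 'rV[R]_d) (L : R).
Hypothesis L0 : 0 <= L.
Hypothesis v_cont : {within @slab R d, continuous (fun z => v z.1 z.2)}.
Hypothesis v_diff : forall (t : R) x, t \in `[0, 1] ->
  cvg (time_quot v t x @ time_incr t) /\ differentiable (v t) x.
Hypothesis dv_cont : forall a,
  {within @slab R d, continuous (fun z => pderiv a v z.1 z.2)}.
Hypothesis dv_bound :
  forall a (t : R) x, t \in `[0, 1] -> `|pderiv a v t x| <= L.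

Lemma is_derive_time (t : R) x : t \in `]0, 1[ ->
  is_derive t 1 (fun s => v s x) (pderiv None v t x).
Proof.
move=> t01; have [cv _] := v_diff t x (subset_itv_oo_cc t01).
rewrite (time_incr_interior _ _ t01) in cv.
have -> : pderiv None v t x = lim (time_quot v t x @ 0^').
  by rewrite -(time_incr_interior _ _ t01).
have E : (fun h : R => h^-1 *: (((fun s => v s x) \o shift t) (h *: 1) - v t x))
    = time_quot v t x.
  by apply/funext => h; rewrite /time_quot/= -[h *: 1]/(h * 1) mulr1 (addrC h).
by apply: DeriveDef; rewrite /derivable /derive E.
Qed.

Lemma continuous_time x : {within `[0, 1], continuous (fun s => v s x)}.
Proof.
apply: (slab_curve_continuous _ _ _ v (cst x)) => //.
by apply: continuous_subspaceT => s; exact: cvg_cst.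
Qed.

(** Coordinatewise, since the mean value equality fails for vector-valued functions: [c] depends on
    [j]. *)
Lemma mvt_time (s t : R) x j : 0 <= s -> s < t -> t <= 1 ->
  exists2 c, c \in `]s, t[ &
    v t x 0 j - v s x 0 j = pderiv None v c x 0 j * (t - s).
Proof.
move=> s0 st t1.
apply: (@MVT R (fun r => v r x 0 j) (fun r => pderiv None v r x 0 j)) => //.
  move=> r; rewrite in_itv/= => /andP[sr rt].
  have r01 : r \in `]0, 1[.
    by rewrite in_itv/= (le_lt_trans s0 sr) (lt_le_trans rt t1).
  exact: (is_derive_coord _ _ _ _ _ j (is_derive_time r x r01)).
apply: continuous_subspaceW (_ : `[s, t] `<=` `[0, 1]) _.
  move=> r /=; rewrite !in_itv/= => /andP[sr rt].
  by rewrite (le_trans s0)// (le_trans rt).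
exact: (within_continuous_coord _ _ _ _ _ j (continuous_time x)).
Qed.

Lemma lipschitz_time (s t : R) x : s \in `[0, 1] -> t \in `[0, 1] ->
  `|v t x - v s x| <= L * `|t - s|.
Proof.
wlog st : s t / s <= t => [wl s01 t01|].
  have [st|/ltW ts] := leP s t; first exact: wl.
  by rewrite distrC (distrC t); exact: wl.
rewrite !in_itv/= => /andP[s0 s1] /andP[t0 t1].
apply: rV_norm_le => [|j]; first exact: mulr_ge0.
have [<-|/eqP snt] := eqVneq s t; first by rewrite subrr mxE normr0 mulr_ge0.
have st' : s < t by rewrite lt_neqAle st andbT; apply/eqP.
have [c cst] := mvt_time s t x j s0 st' t1; rewrite !mxE => ->.
rewrite normrM ler_wpM2r//; apply: (le_trans (rV_coord_le _ _ _ _)).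
apply: dv_bound; move: cst; rewrite !in_itv/= => /andP[sc ct].
by rewrite (le_trans s0 (ltW sc)) (le_trans (ltW ct) t1).
Qed.

Lemma diff_bound (t : R) x h : t \in `[0, 1] ->
  `|'d (v t) x h| <= d%:R * L * `|h|.
Proof.
move=> t01; rewrite diff_rV; last by have [] := v_diff t x t01.
apply: (le_trans (ler_norm_sum _ _ _)).
rewrite -mulrA -[d in d%:R]card_ord mulr_natl -sumr_const.
apply: ler_sum => i _; rewrite normrZ mulrC.
apply: ler_pM => //; last exact: rV_coord_le.
exact: (dv_bound (Some i)).
Qed.

(** Mean value theorem, coordinate by coordinate, along the segment from [y] to [x]; the factor [d]
    comes from summing the partial derivatives in the differential. *)
Lemma lipschitz_space (t : R) x y : t \in `[0, 1] ->
  `|v t x - v t y| <= d%:R * L * `|x - y|.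
Proof.
move=> t01; apply: rV_norm_le => [|j]; first by rewrite !mulr_ge0.
pose c : R -> 'rV[R]_d := cst y + *:%R^~ (x - y).
have dc (r : R) : is_derive r 1 c (x - y).
  rewrite -[X in is_derive _ _ _ X]add0r; apply: is_deriveD.
  have ds : differentiable ( *:%R^~ (x - y) : R -> 'rV[R]_d) r by [].
  by apply: DeriveDef; [exact: diff_derivable|rewrite deriveE// diff_val scale1r].
pose g (r : R) := v t (c r) 0 j.
have dg (r : R) : is_derive r 1 g ('d (v t) (c r) (x - y) 0 j).
  apply: is_derive_coord; apply: is_derive_curve.
  by have [] := v_diff t (c r) t01.
have [|r _] := @MVT_segment R g _ 0 1 ler01 (fun r _ => dg r).
  by apply: derivable_within_continuous => r _; exact: ex_derive.
rewrite /g /c !fctE scale0r scale1r addr0 addrC subrK subr0 mulr1 !mxE => ->.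
exact: (le_trans (rV_coord_le _ _ _ _) (diff_bound _ _ _ t01)).
Qed.

Lemma cvg_shift_right (t : R) : t + h @[h --> 0^'+] --> t.
Proof.
apply: cvg_at_right_filter; rewrite -[X in _ --> X]addr0.
by apply: cvgD; [exact: cvg_cst|exact: cvg_id].
Qed.

Lemma curve_velocity (x : R -> 'rV[R]_d) (t : R) x' :
  t \in `]0, 1[ -> is_derive t 1 x x' ->
  h^-1 *: (v (t + h) (x (t + h)) - v t (x t)) @[h --> 0^'+] -->
    pderiv None v t (x t) + 'd (v t) (x t) x'.
Proof.
move=> t01 dx; have t01' := subset_itv_oo_cc t01.
have [_ dvt] := v_diff t (x t) t01'.
(* Differentiability of v in space at time t handles the increment of x; the
   increment of t is handled at the moved point x (t + h) by the mean value
   theorem and the joint continuity of the time derivative. *)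
have part2 : h^-1 *: (v t (x (t + h)) - v t (x t)) @[h --> 0^'+] -->
    'd (v t) (x t) x'.
  have [dc <-] := is_derive_curve _ _ _ (v t) x x' t dx dvt.
  apply: cvg_dnbhs_at_right.
  rewrite (_ : (fun h => _) = (fun h : R => h^-1 *:
    (((v t \o x) \o shift t) (h *: 1) - (v t \o x) t))); first exact: dc.
  by apply/funext => h /=; rewrite -[h *: 1]/(h * 1) mulr1 (addrC h).
have part1 : h^-1 *: (v (t + h) (x (t + h)) - v t (x (t + h))) @[h --> 0^'+] -->
    pderiv None v t (x t).
  apply/cvgrPdist_le => e e0.
  have /subspace_continuousP/(_ (t, x t) (conj t01' I)) := dv_cont None.
  move=> /cvgrPdist_le /(_ e e0) /nbhs_ballP[del /= del0 ballP].
  have cx : x (t + h) @[h --> 0^'+] --> x t.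
    have /differentiable_continuous : differentiable x t.
      by apply/derivable1_diffP; exact: ex_derive.
    exact: cvg_comp (cvg_shift_right t).
  move: t01; rewrite in_itv/= => /andP[t0 t1].
  near=> h.
  have h0 : 0 < h by near: h; exact: nbhs_right_gt.
  have h1 : t + h <= 1.
    by rewrite -lerBrDl ltW//; near: h; apply: nbhs_right_lt; rewrite subr_gt0.
  have hd : h < del by near: h; exact: nbhs_right_lt.
  have xd : ball (x t) del (x (t + h)) by near: h; exact: (cvg_ball cx).
  apply: rV_norm_le => [|j]; first exact: ltW.
  have tth : t < t + h by rewrite ltrDl.
  have [c] := mvt_time t (t + h) (x (t + h)) j (ltW t0) tth h1.
  rewrite in_itv/= => /andP[tc ct]; rewrite !mxE => ->.
  rewrite addrAC subrr add0r mulrCA mulVf ?gt_eqF// mulr1.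
  have tcd : ball t del c.
    by rewrite /ball/= ltr_distlC; apply/andP; split; lra.
  have c01 : c \in `[0, 1] by rewrite in_itv/=; apply/andP; split; lra.
  have hb : `|pderiv None v t (x t) - pderiv None v c (x (t + h))| <= e.
    exact: ballP (c, x (t + h)) (conj tcd xd) (conj c01 I).
  apply: (le_trans _ hb).
  have := rV_coord_le _ _ (pderiv None v t (x t) - pderiv None v c (x (t + h))) j.
  by rewrite !mxE.
rewrite (_ : (fun h => _) = (fun h =>
   h^-1 *: (v (t + h) (x (t + h)) - v t (x (t + h))) +
   h^-1 *: (v t (x (t + h)) - v t (x t)))); first exact: cvgD.
by apply/funext => h; rewrite -scalerDr addrA subrK.
Unshelve. all: by end_near. Qed.

Lemma flow_end_velocity (x : R -> 'rV[R]_d) (t : R) x' :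
  t \in `]0, 1[ -> is_derive t 1 x x' ->
  D^-1 *: (flow_end v t (x t) - flow_end v (t + D) (x (t + D))) @[D --> 0^'+]
    --> v t (x t) - x' - (1 - t) *: (pderiv None v t (x t) + 'd (v t) (x t) x').
Proof.
move=> t01 dx; have cq := curve_velocity x t x' t01 dx.
set T := (X in _ *: X); pose q D := D^-1 *: (v (t + D) (x (t + D)) - v t (x t)).
pose p D := D^-1 *: (x (t + D) - x t).
have cp : p D @[D --> 0^'+] --> x'.
  have [dc <-] := dx; apply: cvg_dnbhs_at_right.
  rewrite (_ : p = (fun h : R => h^-1 *: ((x \o shift t) (h *: 1) - x t))).
    exact: dc.
  by apply/funext => h /=; rewrite /p -[h *: 1]/(h * 1) mulr1 (addrC h).
have c0 : D @[D --> (0 : R)^'+] --> (0 : R).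
  by apply: cvg_at_right_filter; exact: cvg_id.
(* Exact for [D > 0]: the product rule for [(1 - t) v], with [v] at the later time written as its
   value at [t] plus [D *: q D]. That last term tends to 0, since [q] converges. *)
apply: (@cvg_trans _
    ((v t (x t) + D *: q D - p D - (1 - t) *: q D) @[D --> 0^'+])).
  apply: near_eq_cvg; near=> D.
  have D0 : 0 < D by near: D; exact: nbhs_right_gt.
  by apply/rowP => j; rewrite /flow_end !mxE; field; rewrite gt_eqF.
rewrite -[X in X - x']addr0 -(scale0r T).
apply: cvgB; last by apply: cvgZ; [exact: cvg_cst|exact: cq].
apply: cvgB => //; apply: cvgD; first exact: cvg_cst.
by apply: cvgZ => //; exact: cq.
Unshelve. all: by end_near. Qed.

(** [V] pays for the variation of the factor [1 - t], [M] for the motion of the point, and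
    [L + d%:R * L * M] for the variation of [v] along the curve, in time and then in space. *)
Lemma flow_end_increment (M V : R) (x : R -> 'rV[R]_d) (t D : R) :
  0 <= M ->
  (forall s r, s \in `[0, 1] -> r \in `[0, 1] ->
    `|x r - x s| <= M * `|r - s|) ->
  (forall (s : R) y, s \in `[0, 1] -> `|v s y| <= V) ->
  0 < D -> t \in `[0, 1 - D] ->
  `|flow_end v t (x t) - flow_end v (t + D) (x (t + D))| <=
    (V + M + (L + d%:R * L * M)) * D.
Proof.
move=> M0 xM vV D0; rewrite in_itv/= => /andP[t0 t1].
have t01 : t \in `[0, 1] by rewrite in_itv/=; apply/andP; split; lra.
have tD01 : t + D \in `[0, 1] by rewrite in_itv/=; apply/andP; split; lra.
have tDt : `|t + D - t| = D by rewrite addrAC subrr add0r gtr0_norm.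
have -> : flow_end v t (x t) - flow_end v (t + D) (x (t + D)) =
    D *: v (t + D) (x (t + D)) - (x (t + D) - x t) -
    (1 - t) *: (v (t + D) (x (t + D)) - v t (x t)).
  by apply/rowP => j; rewrite /flow_end !mxE; ring.
have bx : `|x (t + D) - x t| <= M * D.
  by have := xM t (t + D) t01 tD01; rewrite tDt.
have bv : `|v (t + D) (x (t + D)) - v t (x t)| <= (L + d%:R * L * M) * D.
  rewrite -[X in `|X|](subrKA (v t (x (t + D)))) mulrDl.
  apply: (le_trans (ler_normD _ _)); apply: lerD.
    by have := lipschitz_time t (t + D) (x (t + D)) t01 tD01; rewrite tDt.
  apply: (le_trans (lipschitz_space _ _ _ t01)).
  by rewrite -!mulrA !ler_wpM2l.
rewrite !mulrDl; apply: (le_trans (ler_normB _ _)); apply: lerD.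
  apply: (le_trans (ler_normB _ _)); apply: lerD => //.
  by rewrite normrZ gtr0_norm// mulrC; apply: ler_wpM2r; [exact: ltW|exact: vV].
rewrite -mulrDl normrZ; apply: le_trans bv.
by rewrite ler_piMl// ger0_norm; lra.
Qed.

End Velocity.

(** * Joint measurability in time and sample point *)

Section JointMeasurability.
Context (R : realType) (d : nat) (dO : measure_display).
Context (Omega : measurableType dO) (X : R -> Omega -> 'rV[R]_d).
Hypothesis X_meas : forall s, s \in `[0, 1] ->
  measurable_fun [set: Omega] (X s : Omega -> borelV R d).
Hypothesis X_cont : forall w, {within `[0, 1], continuous (X^~ w)}.

Local Notation S01 :=
  ((`[0, 1]%classic `*` setT) : set (measurableTypeR R * Omega)).

Let mS01 : measurable S01. Proof. exact: measurableX. Qed.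

Let X_open s : s \in `[0, 1] ->
  forall U, open U -> measurable (X s @^-1` U).
Proof.
move=> s01 U oU; rewrite -[_ @^-1` _]setTI; apply: (X_meas s s01) => //.
exact: sub_sigma_algebra.
Qed.

Lemma measurable_slab_curve (g : R -> 'rV[R]_d -> R) :
  {within @slab R d, continuous (fun z => g z.1 z.2)} ->
  measurable_fun S01 (fun z => g z.1 (X z.1 z.2)).
Proof.
move=> cg; apply: (measurability _ (RGenOpens.measurableE R)).
move=> _ [_ [a [b ->]] <-].
apply: (caratheodory_preimage_open _ _ _ _ (fun s w => g s (X s w))).
- move=> s s01 U oU; apply: (X_open s s01 (g s @^-1` U)).
  by apply: open_comp => // y _; exact: slab_section_continuous.
- by move=> w; exact: (slab_curve_continuous _ _ _ g (X^~ w)).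
- exact: interval_open.
Qed.

(** Needed for the terms in [u]: as [u] is only Borel, its value along a trajectory need not be
    continuous in time, and its measurability comes from composition with this map. *)
Lemma measurable_curve :
  measurable_fun S01 (fun z => X z.1 z.2 : borelV R d).
Proof.
apply: (@measurability _ _ _ (borelV R d) _ _
  (@open 'rV[R]_d : set (set (borelV R d))) erefl) => _ [U oU <-].
exact: (caratheodory_preimage_open _ _ _ _ X X_open X_cont U oU).
Qed.

Lemma measurable_field_curve (u : R -> 'rV[R]_d -> 'rV[R]_d) i :
  measurable_field u ->
  measurable_fun S01 (fun z => u z.1 (X z.1 z.2) 0 i).
Proof.
move=> mu.
(* X is extended by the default value off the slab to get a total function. *)
pose h : measurableTypeR R * Omega -> R * borelV R d :=
  fun z => (z.1, ((fun z => X z.1 z.2 : borelV R d) \_ S01) z).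
have mh : measurable_fun setT h.
  apply: measurable_fun_pair; first exact: measurable_fst.
  by apply: (measurable_restrictT _ _).1 => //; exact: measurable_curve.
have mc : measurable_fun setT ((fun y => y 0 i) : borelV R d -> R).
  apply: (measurability _ (RGenOpens.measurableE R)).
  move=> _ [_ [a [b ->]] <-]; rewrite setTI; apply: sub_sigma_algebra.
  by apply: open_comp; [move=> y _; exact: coord_continuous|
    exact: interval_open].
apply: (@eq_measurable_fun _ _ _ _ _
  ((fun y : borelV R d => y 0 i) \o ((fun z => u z.1 z.2 : borelV R d) \o h))).
  by move=> z zS; rewrite /h/= patchE zS.
apply: measurableT_comp => //.
apply: (measurable_comp _ _ mu); last exact: measurable_funTS.
  exact: measurableX.
by move=> _ [[t w] [/= t01 _] <-].
Qed.

End JointMeasurability.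

(** * Euclidean norm and assembly of the expansion *)

Lemma sqnorm2_ge0 (R : realType) d (y : 'rV[R]_d) : 0 <= sqnorm2 y.
Proof. by apply: sumr_ge0 => i _; exact: sqr_ge0. Qed.

Lemma sqnorm2_le (R : realType) d (y : 'rV[R]_d) c :
  `|y| <= c -> sqnorm2 y <= d%:R * c ^+ 2.
Proof.
move=> yc; rewrite -[d in d%:R]card_ord mulr_natl -sumr_const.
apply: ler_sum => i _; rewrite -real_normK ?num_real//.
by rewrite lerXn2r ?nnegrE// ?(le_trans (rV_coord_le _ _ _ _) yc)//
  (le_trans _ yc).
Qed.

Lemma sqnorm2Z (R : realType) d (k : R) (y : 'rV[R]_d) :
  sqnorm2 (k *: y) = k ^+ 2 * sqnorm2 y.
Proof.
by rewrite /sqnorm2 mulr_sumr; apply: eq_bigr => i _; rewrite mxE exprMn.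
Qed.

Lemma sqnorm2_continuous (R : realType) d : continuous (@sqnorm2 R d).
Proof.
suff H (y : 'rV[R]_d) : sqnorm2 z @[z --> y] --> sqnorm2 y by exact: H.
apply: (@cvg_big R 'I_d +%R 0 xpredT add_continuous _ (nbhs y) _
  (fun i (z : 'rV[R]_d) => z 0 i ^+ 2)) => i _.
by rewrite expr2; apply: cvgM; exact: coord_continuous.
Qed.

Lemma lipschitz_within_continuous (R : realType) (V : normedModType R)
    (S : set R) (y : R -> V) (M : R) : 0 <= M ->
  (forall s t, S s -> S t -> `|y t - y s| <= M * `|t - s|) ->
  {within S, continuous y}.
Proof.
move=> M0 yM; apply/subspace_continuousP => t St.
apply/cvgrPdist_le => e e0.
(* [M] may be 0, so the radius is [e / (M + 1)]. *)
have M1 : 0 < M + 1 by rewrite ltr_wpDl.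
have : \forall s \near t, `|t - s| <= e / (M + 1).
  apply/nbhs_ballP; exists (e / (M + 1)); first exact: divr_gt0.
  by move=> s /ltW.
rewrite /within/=; apply: filterS => s ts Ss.
apply: (le_trans (yM _ _ Ss St)); apply: (le_trans (ler_wpM2l M0 ts)).
by rewrite mulrCA ger_pMr// ler_pdivrMr// mul1r lerDl.
Qed.

Lemma total_derivE (R : realType) d (u v : R -> 'rV[R]_d -> 'rV[R]_d) t x :
  differentiable (v t) x ->
  total_deriv u v t x = pderiv None v t x + 'd (v t) x (u t x).
Proof. by move=> dv; rewrite /total_deriv -deriveEjacobian// deriveE. Qed.

Lemma flow_end_continuous (R : realType) d (v : R -> 'rV[R]_d -> 'rV[R]_d) :
  {within @slab R d, continuous (fun z => v z.1 z.2)} ->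
  {within @slab R d, continuous (fun z => flow_end v z.1 z.2)}.
Proof.
move=> cv z; apply: cvgD.
  by apply: (continuous_subspaceT (f := snd)) => y; exact: cvg_snd.
apply: cvgZ; last exact: cv.
apply: (continuous_subspaceT (f := fun y : R * 'rV[R]_d => 1 - y.1)) => y.
by apply: cvgB; [exact: cvg_cst|exact: cvg_fst].
Qed.

Theorem theorem1 (R : realType) (d : nat)
    (p0 p1 : probability (borelV R d) R)
    (p : R -> probability (borelV R d) R)
    (hp0 : p 0 = p0) (hp1 : p 1 = p1)
    (u : R -> 'rV[R]_d -> 'rV[R]_d)
    (hu_meas : measurable_field u)
    (hu_bounded : bounded_slab u)
    (dO : measure_display) (Omega : measurableType dO)
    (P : probability Omega R)
    (X : R -> Omega -> 'rV[R]_d)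
    (hX : generates P X u p)
    (hu_cont : continuity_equation u p)
    (v : R -> 'rV[R]_d -> 'rV[R]_d)
    (hv_C2 : Ck_slab 2 v)
    (hv_bounded : bounded_slab v)
    (hv_bounded1 : forall a, bounded_slab (pderiv a v))
    (hv_bounded2 : forall a b, bounded_slab (pderiv b (pderiv a v))) :
  exists rem : R -> R,
    (rem : R^o -> R^o) =o_ (0^'+) (fun D : R^o => D ^+ 2 : R^o) /\
    forall (D : R) (hD : 0 < 1 - D), 0 < D ->
      ('E_(uniform_prob hD \x P)
          [fun z => sqnorm2 (flow_end v z.1 (X z.1 z.2)
                             - flow_end v (z.1 + D) (X (z.1 + D)%R z.2))]
       = (D ^+ 2)%:E *
         'E_(uniform_prob hD \x P)
          [fun z => sqnorm2 (v z.1 (X z.1 z.2) - u z.1 (X z.1 z.2)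
                             - (1 - z.1) *: total_deriv u v z.1 (X z.1 z.2))]
         + (rem D)%:E)%E.
Proof.
have [v_cont [v_diff dv_Ck]] := hv_C2.
have dv_cont a : {within @slab R d, continuous (fun z => pderiv a v z.1 z.2)}.
  by have [] := dv_Ck a.
have [M M0 uM] : exists2 M, 0 <= M &
    forall (t : R) y, t \in `[0, 1] -> `|u t y| <= M.
  have [M uM] := hu_bounded; exists `|M| => // t y t01.
  exact: (le_trans (uM t y t01) (ler_norm _)).
have [V vV] := hv_bounded.
have [L L0 dvL] : exists2 L, 0 <= L &
    forall a (t : R) y, t \in `[0, 1] -> `|pderiv a v t y| <= L.
  (* The sum dominates the bounds of all first derivatives, in time and space, at once. *)
  have [Lf LfP] := choice hv_bounded1; exists (\sum_a `|Lf a|).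
    exact: sumr_ge0.
  move=> a t y t01; apply: (le_trans (LfP a t y t01)).
  by rewrite (bigD1 a)//=; apply: (le_trans (ler_norm _));
    rewrite lerDl sumr_ge0.
have X_lip w s t : s \in `[0, 1] -> t \in `[0, 1] ->
    `|X t w - X s w| <= M * `|t - s|.
  exact: (ode_lipschitz _ _ u (fun r => X r w) M M0 uM (gen_ode hX w)).
have X_cont w : {within `[0, 1], continuous (X^~ w)}.
  by apply: (lipschitz_within_continuous _ _ _ _ M M0) => s t; exact: X_lip.
have X_meas := gen_measurable hX.
pose S01 := (`[0, 1]%classic `*` setT) : set (measurableTypeR R * Omega).
have mcoord g j : {within @slab R d, continuous (fun z => g z.1 z.2)} ->
    measurable_fun S01 (fun z => (g z.1 (X z.1 z.2) : 'rV[R]_d) 0 j).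
  move=> cg; apply: (measurable_slab_curve _ _ _ _ _ X_meas X_cont
    (fun t x => g t x 0 j)).
  exact: (within_continuous_coord _ _ _ _ _ j cg).
pose Fl (z : measurableTypeR R * Omega) := flow_end v z.1 (X z.1 z.2).
(* The same [c] bounds the increment divided by [D] and the vector in the limit; the factor [d] in
   [d%:R * c ^+ 2] converts the sup norm into the Euclidean one. *)
pose c := V + M + (L + d%:R * L * M).
apply: (@expectation_littleo R dO Omega P
  (fun D z => sqnorm2 (flow_end v z.1 (X z.1 z.2)
                       - flow_end v (z.1 + D) (X (z.1 + D)%R z.2)))
  (fun z => sqnorm2 (v z.1 (X z.1 z.2) - u z.1 (X z.1 z.2)
                     - (1 - z.1) *: total_deriv u v z.1 (X z.1 z.2)))
  (d%:R * c ^+ 2)).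
- by move=> D z; exact: sqnorm2_ge0.
- by move=> z; exact: sqnorm2_ge0.
- move=> D D0; rewrite /sqnorm2; apply: measurable_sum => j.
  apply: measurable_funX.
  have mFl : measurable_fun S01 (fun z => Fl z 0 j).
    by apply: mcoord; exact: flow_end_continuous.
  (* The later term is [Fl] after a time shift that sends [[0, 1 - D]] into [[0, 1]], so one
     measurability statement covers both terms. *)
  pose shift_time (z : measurableTypeR R * Omega) :
    measurableTypeR R * Omega := (z.1 + D, z.2).
  have mshift : measurable_fun setT shift_time.
    apply: measurable_fun_pair; last exact: measurable_snd.
    by apply: measurable_funD => //; exact: measurable_fst.
  apply: (eq_measurable_fun (fun z => Fl z 0 j - Fl (shift_time z) 0 j)).
    by move=> z _; rewrite !mxE.
  have sub : `[0, 1 - D]%classic `*` setT `<=` S01.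
    move=> [t w] [/= + _]; rewrite in_itv/= => /andP[t0 t1].
    by split => //=; rewrite in_itv/=; apply/andP; split; lra.
  apply: measurable_funB.
    by apply: measurable_funS mFl => //; exact: measurableX.
  apply: (measurable_comp _ _ mFl); last exact: measurable_funTS.
    exact: measurableX.
  move=> _ [[t w] [/= + _] <-]; rewrite in_itv/= => /andP[t0 t1].
  by split => //=; rewrite in_itv/=; apply/andP; split; lra.
- rewrite /sqnorm2; apply: measurable_sum => j; apply: measurable_funX.
  pose U i (z : measurableTypeR R * Omega) := u z.1 (X z.1 z.2) 0 i.
  pose W a (z : measurableTypeR R * Omega) := pderiv a v z.1 (X z.1 z.2) 0 j.
  (* Expanding the differential separates the Borel factors [U i] from the continuous factors [W a],
     whose measurability has different sources. *)
  apply: (eq_measurable_fun (fun z => v z.1 (X z.1 z.2) 0 j - U j z -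
    (1 - z.1) * (W None z + \sum_i U i z * W (Some i) z))).
    move=> [t w]; rewrite inE => -[/= t01 _].
    have [_ dv] := v_diff t (X t w) t01.
    rewrite /U /W/= total_derivE// diff_rV// !mxE summxE.
    by congr (_ - _ * (_ + _)); apply: eq_bigr => i _; rewrite mxE.
  have mU i : measurable_fun S01 (U i).
    exact: (measurable_field_curve _ _ _ _ _ X_meas X_cont).
  have mW a : measurable_fun S01 (W a) by exact: mcoord.
  apply: measurable_funB.
    by apply: measurable_funB; [exact: mcoord|exact: mU].
  apply: measurable_funM.
    apply: measurable_funB => //; apply: measurable_funTS.
    exact: measurable_fst.
  apply: measurable_funD; first exact: mW.
  by apply: measurable_sum => i; apply: measurable_funM; [exact: mU|exact: mW].
- move=> D t w D0 tD /=.
  rewrite -mulrA -exprMn; apply: sqnorm2_le.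
  exact: (flow_end_increment _ _ v L L0 v_cont v_diff dvL M V (fun s => X s w)
    t D M0 (X_lip w) vV D0 tD).
- move=> t w t01 /=; apply: sqnorm2_le.
  have [_ dv] := v_diff t (X t w) t01.
  rewrite total_derivE//; apply: (le_trans (ler_normB _ _)); apply: lerD.
    apply: (le_trans (ler_normB _ _)); apply: lerD; [exact: vV|exact: uM].
  rewrite normrZ; apply: (@le_trans _ _
    (`|pderiv None v t (X t w) + 'd (v t) (X t w) (u t (X t w))|)).
    move: t01; rewrite in_itv/= => /andP[t0 t1].
    by rewrite ler_piMl// ger0_norm; lra.
  apply: (le_trans (ler_normD _ _)); apply: lerD; first exact: dvL.
  apply: (le_trans (diff_bound _ _ v L v_diff dvL t _ _ t01)).
  by rewrite ler_wpM2l ?mulr_ge0// uM.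
- move=> w; have := ode_derive _ _ u (fun r => X r w) (gen_ode hX w).
  apply: filterS; first exact: (ae_filter_ringOfSetsType lebesgue_measure).
  move=> t Xt t01 /=; have [dX DX] := Xt t01.
  have dXt : is_derive (t : R) 1 (fun r => X r w) (u t (X t w)).
    by rewrite -DX; exact: DeriveDef.
  have [_ dv] := v_diff t (X t w) (subset_itv_oo_cc t01).
  rewrite total_derivE//.
  (* The vector quotient converges; continuity of [sqnorm2] and its homogeneity of degree 2 turn
     this into convergence of the squared increment over [D ^+ 2]. *)
  have := flow_end_velocity _ _ v v_cont v_diff dv_cont
    (fun r => X r w) t _ t01 dXt.
  move=> /(cvg_comp _ _)/(_ (sqnorm2_continuous R d _)).
  apply: cvg_trans; apply: near_eq_cvg; near=> D.
  by rewrite /= sqnorm2Z exprVn mulrC.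
Unshelve. all: by end_near. Qed.
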